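(* Let $R$ be a finite chain ring with maximal ideal $\langle\gamma\rangle$, even index of nilpotency $e$ of $\gamma$, and residue field $K$ with $|K|=p^r$ ($p$ prime), so $|R|=p^{er}$. Let $n$ be a positive integer with $\gcd(n,p)=1$. Then there exists a non-trivial cyclic self-dual code of length $n$ over $R$ if and only if $(p^r)^i\not\equiv -1\pmod n$ for all positive integers $i$.
   Context: A finite chain ring is a finite commutative local ring whose ideals are linearly ordered; its maximal ideal is principal, generated by a nilpotent $\gamma$ whose nilpotency index is $e$, and $K=R/\langle\gamma\rangle$ is its residue field. A code of length $n$ over $R$ is an $R$-submodule of $R^n$; it is cyclic if closed under the cyclic shift $(c_0,\dots,c_{n-1})\mapsto(c_{n-1},c_0,\dots,c_{n-2})$. The dual is $C^\perp=\{u\in R^n:\sum u_iv_i=0\ \forall v\in C\}$ and $C$ is self-dual if $C=C^\perp$. When $e$ is even, $\gamma^{e/2}R^n$ (generated by $\gamma^{e/2}I_n$) is a self-dual cyclic code, called the trivial self-dual code; a non-trivial self-dual code is a self-dual code different from it. *)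

(* Defs.v *)
From HB Require Import structures.
From mathcomp Require Import all_boot all_order all_algebra.
Set Implicit Arguments. Unset Strict Implicit. Unset Printing Implicit Defensive.
Import Order.TTheory GRing.Theory Num.Theory.
Local Open Scope ring_scope.

Section ChainRing.
Variable R : finComUnitRingType.

Definition is_ideal (I : {set R}) : bool :=
  [&& 0 \in I,
      [forall x in I, forall y in I, x + y \in I] &
      [forall a : R, forall x in I, a * x \in I]].

Definition principal_ideal (g : R) : {set R} := [set g * a | a : R].

(* the set of non-units; R is local iff it is an ideal (then it is the
   unique maximal ideal) *)
Definition nonunits : {set R} := [set x | x \isn't a GRing.unit].

Definition is_local_ring : bool := is_ideal nonunits.

Definition is_chain_ring : bool :=
  is_local_ring &&
  [forall I : {set R}, forall J : {set R},
     (is_ideal I && is_ideal J) ==> ((I \subset J) || (J \subset I))].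

Definition nilpotency_index (g : R) (e : nat) : Prop :=
  g ^+ e = 0 /\ forall k, (k < e)%N -> g ^+ k != 0.

(* the residue field K = R / <g>, as the set of additive cosets of <g> *)
Definition residue_classes (g : R) : {set {set R}} :=
  [set [set x + m | m in principal_ideal g] | x : R].

Definition is_code (n : nat) (C : {set 'rV[R]_n}) : bool :=
  [&& 0 \in C,
      [forall u in C, forall v in C, u + v \in C] &
      [forall a : R, forall v in C, a *: v \in C]].

(* cyclic shift (c_0,...,c_{n-1}) |-> (c_{n-1}, c_0, ..., c_{n-2}) *)
Definition cshift (n : nat) (v : 'rV[R]_n) : 'rV[R]_n :=
  \row_(i < n) v 0 (ord_pred i).

Definition is_cyclic_code (n : nat) (C : {set 'rV[R]_n}) : bool :=
  is_code C && [forall v in C, cshift v \in C].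

Definition inner (n : nat) (u v : 'rV[R]_n) : R := \sum_(i < n) u 0 i * v 0 i.

Definition dual_code (n : nat) (C : {set 'rV[R]_n}) : {set 'rV[R]_n} :=
  [set u | [forall v in C, inner u v == 0]].

Definition self_dual (n : nat) (C : {set 'rV[R]_n}) : bool := C == dual_code C.

Definition trivial_code (n : nat) (g : R) (e : nat) : {set 'rV[R]_n} :=
  [set g ^+ (e./2) *: v | v : 'rV[R]_n].

End ChainRing.

(* Main.v *)
(** Write q = |K| and S = R[x]/(x^n - 1).  Cyclic codes of length n are the
    ideals of S, and the dual of an ideal C is the set of all u such that
    u v^* = 0 for every v in C, where * is the involution x |-> x^-1.

    If q^i = -1 mod n, then * is the q^i-th power map on S/gamma, where hence
    v v^* = 0 forces v = v^(q^(2i)) = 0.  So u = gamma^k v in a self-dual code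
    with k < e/2 has v = 0 modulo gamma: the code lies in gamma^(e/2) S, and
    equals it by duality.

    Otherwise let b be the sum of the x^j over the orbit of j = 1 under
    multiplication by q.  In S/gamma, b^q = b but b^* <> b.  If all the
    idempotents (b - c)^(q-1), for c in K, were fixed by *, then
    (b - b^* ) (b - c)^(q-1) = b - b^* for every c, and the product over c,
    which contains the factor b^q - b = 0, would give b = b^*.  So S/gamma has
    an idempotent E with E^* <> E, and a = E (1 - E^* ) is a nonzero idempotent
    with a a^* = 0.  It lifts to S.  With d = 1 - a - a^*, the element
    gamma^(e/2-1) a + gamma^(e/2+1) a^* + gamma^(e/2) d generates a non-trivial
    self-dual ideal. *)

Require Import Defs.
From HB Require Import structures.
From mathcomp Require Import all_boot all_order all_algebra.
From mathcomp Require Import ring zify cyclic finfield.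
Set Implicit Arguments.
Unset Strict Implicit.
Unset Printing Implicit Defensive.
Import Order.TTheory GRing.Theory Num.Theory.
Local Open Scope ring_scope.

(** * The residue field of a finite local ring *)

Section ResidueField.
Variable R : finComUnitRingType.

Lemma is_idealP (I : {set R}) : reflect
  [/\ 0 \in I, {in I &, forall x y, x + y \in I}
    & forall a, {in I, forall x, a * x \in I}]
  (is_ideal I).
Proof.
apply: (iffP and3P) => -[I0 ID IM]; split=> //.
- by move=> x y xI; apply: (forall_inP (forall_inP ID x xI)).
- by move=> a; apply: (forall_inP (forallP IM a)).
- by apply/forall_inP => x xI; apply/forall_inP => y; apply: ID.
- by apply/forallP => a; apply/forall_inP; apply: IM.
Qed.

Hypothesis R_local : is_local_ring R.

(* The phantom argument lets the ideal instance below depend on locality. *)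
Definition max_ideal (_ : is_local_ring R) : {pred R} :=
  [pred x | x \isn't a GRing.unit].
Local Notation M := (max_ideal R_local).

Lemma max_ideal_idealr : idealr_closed M.
Proof.
have /is_idealP[M0 MD MM] := R_local; split=> [||a u v].
- by rewrite inE /= unitr0.
- by rewrite inE /= unitr1.
- rewrite !inE => uM vM; have := MD (a * u) v; rewrite !inE; apply=> //.
  by have := MM a u; rewrite !inE; apply.
Qed.
HB.instance Definition _ := isIdealr.Build R M max_ideal_idealr.

Definition residue_field := {ideal_quot M}.
HB.instance Definition _ := GRing.ComNzRing.on residue_field.

Definition residue : R -> residue_field := \pi_residue_field%qT.
HB.instance Definition _ := GRing.RMorphism.on residue.

Definition residue_repr : residue_field -> R := repr.

Lemma residue_reprK : cancel residue_repr residue.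
Proof. exact: reprK. Qed.

Lemma residue_eq0 a : (residue a == 0) = (a \isn't a GRing.unit).
Proof. by rewrite -(rmorph0 residue) -Quotient.idealrBE subr0. Qed.

Definition residue_inv (x : residue_field) :=
  residue (if x == 0 then 0 else (residue_repr x)^-1).

Lemma mul_residue_inv x : x != 0 -> residue_inv x * x = 1.
Proof.
rewrite /residue_inv => x0; rewrite (negPf x0) -{2}[x]residue_reprK -rmorphM.
rewrite mulVr ?rmorph1 //.
by rewrite -[_ \in _]negbK -residue_eq0 residue_reprK.
Qed.

Lemma residue_inv0 : residue_inv 0 = 0.
Proof. by rewrite /residue_inv eqxx rmorph0. Qed.

HB.instance Definition _ :=
  GRing.ComNzRing_isField.Build residue_field mul_residue_inv residue_inv0.
HB.instance Definition _ : isCountable residue_field :=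
  CanIsCountable residue_reprK.
HB.instance Definition _ : isFinite residue_field := CanIsFinite residue_reprK.

End ResidueField.

(** * Idempotents *)

Lemma expr_idempotent (A : nzRingType) (x : A) k :
  (0 < k)%N -> x ^+ k.+1 = x -> x ^+ k * x ^+ k = x ^+ k.
Proof. by case: k => // k _ xk; rewrite {1}exprSr -mulrA -exprS xk -exprSr. Qed.

Lemma idempotent_expX (A : nzRingType) (x : A) k :
  (0 < k)%N -> x * x = x -> x ^+ k = x.
Proof. by move=> + xx; elim: k => // -[|k] IHk _ //; rewrite exprS IHk. Qed.

Lemma orthogonal_idempotent (A : comNzRingType) (s : {rmorphism A -> A}) a :
  involutive s -> a * a = a -> s a != a ->
  exists b, [/\ b * b = b, b * s b = 0 & b != 0].
Proof.
move=> sK aa sa; exists (a * (1 - s a)).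
have sasa : s a * s a = s a by rewrite -rmorphM aa.
split.
- transitivity (a * a * (1 - s a - s a + s a * s a)); first by ring.
  by rewrite aa sasa; ring.
- rewrite rmorphM rmorphB rmorph1 sK.
  transitivity ((a - a * a) * (s a - s a * s a)); first by ring.
  by rewrite aa subrr mul0r.
- apply: contraNneq sa; rewrite mulrBr mulr1 => /eqP.
  by rewrite subr_eq0 => /eqP asa; rewrite {1}asa rmorphM /= sK mulrC -asa.
Qed.

Section LiftIdempotent.
Variables (S A : comNzRingType) (f : {rmorphism S -> A}) (N : nat).
Hypothesis ker_nilp : forall x, f x = 0 -> x ^+ N = 0.

(* The lift is 1 - (1 - u^N)^N: it is a multiple of u^N, and its complement a
   multiple of (1 - u)^N. *)
Lemma lift_idempotent u : f u * f u = f u ->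
  exists2 c, u ^+ N * c * (u ^+ N * c) = u ^+ N * c & f (u ^+ N * c) = f u.
Proof.
move=> uu; have N_gt0 : (0 < N)%N.
  rewrite lt0n; apply/eqP => N0; have /eqP := ker_nilp (rmorph0 f).
  by rewrite N0 oner_eq0.
pose geom (x : S) := \sum_(i < N) x ^+ i.
have geomE x : 1 - x ^+ N = (1 - x) * geom x.
  by rewrite -opprB subrX1 -mulNr opprB.
have liftE : u ^+ N * geom (1 - u ^+ N) = 1 - (1 - u ^+ N) ^+ N.
  by rewrite geomE subKr.
exists (geom (1 - u ^+ N)).
  suff: u ^+ N * geom (1 - u ^+ N) * (1 - u ^+ N * geom (1 - u ^+ N)) = 0.
    by rewrite mulrBr mulr1 => /eqP; rewrite subr_eq0 => /eqP.
  rewrite {2}liftE subKr geomE exprMn mulrACA -exprMn ker_nilp ?mul0r //.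
  by rewrite rmorphM rmorphB rmorph1 mulrBr mulr1 uu subrr.
rewrite liftE !(rmorphB, rmorphXn, rmorph1) /= !idempotent_expX // ?subKr //.
by rewrite mulrBl mul1r mulrBr mulr1 uu subrr subr0.
Qed.

Lemma lift_orthogonal_idempotent
    (s : {rmorphism S -> S}) (t : {rmorphism A -> A}) b :
  (forall x, f (s x) = t (f x)) -> (exists u, f u = b) ->
  b * b = b -> b * t b = 0 ->
  exists a, [/\ a * a = a, a * s a = 0 & f a = b].
Proof.
move=> fs [u <-] /lift_idempotent[c ee fe] ut0; exists (u ^+ N * c); split=> //.
by rewrite rmorphM mulrACA rmorphXn -exprMn ker_nilp ?mul0r // rmorphM fs.
Qed.

End LiftIdempotent.

(** * Frobenius in commutative algebras over a finite field *)

Section FiniteFieldAlgebra.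
Variables (F : finFieldType) (A : comAlgType F).
Local Notation q := #|F|.

Lemma pchar_nat_card : [pchar A].-nat q.
Proof.
have [p p_pr pF] := finPcharP F; rewrite (card_pprimeChar pF) pnatX pnatE //.
by rewrite pchar_lalg pF.
Qed.

Lemma expr_card_sum (I : finType) (a : I -> A) :
  (\sum_i a i) ^+ q = \sum_i a i ^+ q.
Proof.
apply: (big_morph (fun u => u ^+ q)) => [u v|].
  exact: exprDn_pchar pchar_nat_card.
by rewrite expr0n gtn_eqF // ltnW ?finNzRing_gt1.
Qed.

Lemma linear_comb_expX (I : finType) (c : I -> F) (a : I -> A) k :
  (\sum_i c i *: a i) ^+ (q ^ k) = \sum_i c i *: a i ^+ (q ^ k).
Proof.
elim: k => [|k IHk]; first by [].
rewrite expnSr exprM IHk expr_card_sum.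
by apply: eq_bigr => i _; rewrite exprZn expf_card exprM.
Qed.

Lemma sub_scalar_expX (b : A) (c : F) :
  b ^+ q = b -> (b - c%:A) ^+ q = b - c%:A.
Proof.
move=> bq; rewrite exprDn_pchar ?pchar_nat_card // bq -scaleNr.
by rewrite exprZn expf_card expr1n.
Qed.

Lemma prod_sub_scalar (b : A) : \prod_(c : F) (b - c%:A) = b ^+ q - b.
Proof.
have := congr1 (horner_alg b) (finField_genPoly F).
rewrite rmorphB rmorphXn rmorph_prod /= horner_algX => ->.
by apply: eq_bigr => c _; rewrite rmorphB /= horner_algX horner_algC.
Qed.

Lemma idempotent_not_fixed (s : {lrmorphism A -> A}) (b : A) :
  b ^+ q = b -> s b != b -> exists2 a, a * a = a & s a != a.
Proof.
move=> bq sb; have q_gt1 := finNzRing_gt1 F.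
have q1_gt0 : (0 < q.-1)%N by rewrite -subn1 subn_gt0.
pose w c := b - c%:A.
have wq c : w c ^+ q.-1.+1 = w c by rewrite prednK ?sub_scalar_expX // ltnW.
have [fixed|/forallPn[c]] :=
    boolP [forall c, s (w c ^+ q.-1) == w c ^+ q.-1]; last first.
  by exists (w c ^+ q.-1); first exact: expr_idempotent.
have absorb c : (b - s b) * w c ^+ q.-1 = b - s b.
  have <- : w c - s (w c) = b - s b.
    by rewrite rmorphB /= linearZ rmorph1 opprB addrA subrK.
  by rewrite mulrBl -exprS wq -{1}(eqP (forallP fixed c)) -rmorphM -exprS wq.
have : (b - s b) * \prod_c w c ^+ q.-1 = b - s b.
  apply: (big_ind (fun u => (b - s b) * u = b - s b)); rewrite ?mulr1 //.
  by move=> u v bu bv; rewrite mulrA bu.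
rewrite prodrXl prod_sub_scalar bq subrr expr0n gtn_eqF // mulr0.
by move/esym/eqP; rewrite subr_eq0 eq_sym (negPf sb).
Qed.

End FiniteFieldAlgebra.

(** * The cyclic algebra and its involution *)

Section CyclicAlgebra.
Variables (R : comNzRingType) (m : nat).
Local Notation n := m.+1.

(* R[x]/(x^n - 1), a polynomial being the row of its coefficients: the exponents
   live in 'I_n, with its addition modulo n. *)
Definition cyc_alg := 'rV[R]_n.
HB.instance Definition _ := GRing.Lmodule.on cyc_alg.
Implicit Types (u v w : cyc_alg) (i j k : 'I_n).

Definition cyc_one : cyc_alg := delta_mx 0 0.
Definition cyc_mul u v : cyc_alg := \row_k \sum_i u 0 i * v 0 (k - i).

Lemma cyc_mulC : commutative cyc_mul.
Proof.
move=> u v; apply/rowP => k; rewrite !mxE (reindex_inj (subrI k)) /=.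
by apply: eq_bigr => i _; rewrite subKr mulrC.
Qed.

Lemma cyc_mulA : associative cyc_mul.
Proof.
move=> u v w; apply/rowP => k; rewrite !mxE.
under eq_bigr do rewrite mxE mulr_sumr.
under [RHS]eq_bigr do rewrite mxE mulr_suml.
rewrite [RHS]exchange_big; apply: eq_bigr => i _ /=.
rewrite [RHS](reindex_inj (addrI i)); apply: eq_bigr => j _.
by rewrite mulrA opprD addrA [i + j]addrC addrK.
Qed.

Lemma cyc_mul1 : left_id cyc_one cyc_mul.
Proof.
move=> u; apply/rowP => k; rewrite mxE (bigD1 0) //= big1 => [|i i0].
  by rewrite mxE !eqxx mul1r subr0 addr0.
by rewrite mxE (negPf i0) mul0r.
Qed.

Lemma cyc_mulDl : left_distributive cyc_mul +%R.
Proof.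
move=> u v w; apply/rowP => k; rewrite !mxE -big_split; apply: eq_bigr => i _.
by rewrite mxE mulrDl.
Qed.

Lemma cyc_one_neq0 : cyc_one != 0.
Proof. by apply/eqP => /rowP/(_ 0)/eqP; rewrite !mxE oner_eq0. Qed.

HB.instance Definition _ := GRing.Zmodule_isComNzRing.Build cyc_alg
  cyc_mulA cyc_mulC cyc_mul1 cyc_mulDl cyc_one_neq0.

Lemma cyc_scaleAl (a : R) u v : a *: (u * v) = (a *: u) * v.
Proof.
apply/rowP => k; rewrite !mxE mulr_sumr.
by apply: eq_bigr => i _; rewrite mxE mulrA.
Qed.
HB.instance Definition _ :=
  GRing.Lmodule_isLalgebra.Build R cyc_alg cyc_scaleAl.
HB.instance Definition _ := GRing.Lalgebra_isComAlgebra.Build R cyc_alg.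

Lemma cyc_mulE u v k : (u * v) 0 k = \sum_i u 0 i * v 0 (k - i).
Proof. by rewrite mxE. Qed.

Definition monomial i : cyc_alg := delta_mx 0 i.

Lemma mul_monomialE i u k : (monomial i * u) 0 k = u 0 (k - i).
Proof.
rewrite cyc_mulE (bigD1 i) //= big1 => [|j ji].
  by rewrite mxE !eqxx mul1r addr0.
by rewrite mxE (negPf ji) mul0r.
Qed.

Lemma monomialX i l : monomial i ^+ l = monomial (i *+ l).
Proof.
elim: l => [|l IHl] //; rewrite exprS IHl; apply/rowP => j.
by rewrite mul_monomialE !mxE /= mulrS subr_eq addrC.
Qed.

Lemma monomial_sum u : u = \sum_i u 0 i *: monomial i.
Proof. exact: row_sum_delta. Qed.

Definition star u : cyc_alg := \row_i u 0 (- i).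

Lemma star_is_linear : linear star.
Proof. by move=> a u v; apply/rowP => k; rewrite !mxE. Qed.
HB.instance Definition _ :=
  GRing.isLinear.Build R cyc_alg cyc_alg _ star star_is_linear.

Lemma star_is_monoid_morphism : monoid_morphism star.
Proof.
split=> [|u v]; apply/rowP => k; first by rewrite !mxE oppr_eq0.
rewrite cyc_mulE mxE cyc_mulE (reindex_inj oppr_inj).
by apply: eq_bigr => i _; rewrite !mxE opprD.
Qed.
HB.instance Definition _ :=
  GRing.isMonoidMorphism.Build cyc_alg cyc_alg star star_is_monoid_morphism.

Lemma starK : involutive star.
Proof. by move=> u; apply/rowP => k; rewrite !mxE opprK. Qed.

Lemma star_monomial i : star (monomial i) = monomial (- i).
Proof. by apply/rowP => k; rewrite !mxE eqr_oppLR. Qed.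

End CyclicAlgebra.
Arguments star {R m} u.
Arguments starK {R m} x.

Section MapCyclic.
Variables (R K : comNzRingType) (f : {rmorphism R -> K}) (m : nat).

Definition cyc_map (u : cyc_alg R m) : cyc_alg K m := map_mx f u.

Lemma cyc_map_is_zmod_morphism : zmod_morphism cyc_map.
Proof. exact: map_mxB. Qed.
HB.instance Definition _ :=
  GRing.isZmodMorphism.Build _ _ cyc_map cyc_map_is_zmod_morphism.

Lemma cyc_map_is_monoid_morphism : monoid_morphism cyc_map.
Proof.
split=> [|u v]; first exact: map_delta_mx.
apply/rowP => k; rewrite mxE !cyc_mulE rmorph_sum; apply: eq_bigr => i _.
by rewrite rmorphM !mxE.
Qed.
HB.instance Definition _ :=
  GRing.isMonoidMorphism.Build _ _ cyc_map cyc_map_is_monoid_morphism.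

Lemma cyc_map_star u : cyc_map (star u) = star (cyc_map u).
Proof. by apply/rowP => k; rewrite !mxE. Qed.

End MapCyclic.

(** * The cyclic algebra over a finite field *)

Section OrdinalMultiples.
Variable m : nat.
Local Notation n := m.+1.
Implicit Types (i : 'I_n) (k l : nat).

Lemma mulrn_ord_mod i k l : k = l %[mod n] -> i *+ k = i *+ l.
Proof.
by move=> kl; apply: val_inj; rewrite !Zp_mulrn /= -modnMmr kl modnMmr.
Qed.

Lemma mulrn_ord_opp i k : (n %| k + 1)%N -> i *+ k = - i.
Proof.
move=> /eqP k1; apply/eqP; rewrite -subr_eq0 opprK -mulrSr -addn1; apply/eqP.
by rewrite (@mulrn_ord_mod i _ 0) ?mod0n.
Qed.

Lemma mulrn_ord_inj k : coprime n k -> injective (fun i => i *+ k).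
Proof.
move=> nk; apply: (can_inj (g := fun i => i *+ k ^ (totient n).-1)) => i.
rewrite -mulrnA -expnS prednK ?totient_gt0 // (@mulrn_ord_mod i _ 1) //.
by apply: Euler_exp_totient; rewrite coprime_sym.
Qed.

Lemma Zp1_mulrn k : Zp1 *+ k = inZp k :> 'I_n.
Proof. by apply: val_inj; rewrite Zp_mulrn /= modnMml mul1n. Qed.

Lemma Zp1_mulrn_opp k : Zp1 *+ k = - Zp1 :> 'I_n -> (n %| k + 1)%N.
Proof.
move=> /eqP; rewrite -subr_eq0 opprK -mulrSr -addn1 Zp1_mulrn => /eqP.
by move=> /(congr1 val)/eqP.
Qed.

End OrdinalMultiples.

Lemma iter_mulrn_expn (V : nmodType) (x : V) k l :
  iter k (fun y => y *+ l) x = x *+ l ^ k.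
Proof. by elim: k => // k IHk; rewrite iterS IHk -mulrnA expnSr. Qed.

Section FrobeniusCyclic.
Variables (F : finFieldType) (m : nat).
Local Notation n := m.+1.
Local Notation q := #|F|.
Local Notation A := (cyc_alg F m).
Implicit Types u : A.

Lemma cyc_expX u k : u ^+ (q ^ k) = \sum_i u 0 i *: monomial F (i *+ q ^ k).
Proof.
rewrite {1}[u]monomial_sum linear_comb_expX.
by apply: eq_bigr => i _; rewrite monomialX.
Qed.

Lemma star_expX u k : (n %| q ^ k + 1)%N -> star u = u ^+ (q ^ k).
Proof.
move=> qk; rewrite cyc_expX {1}[u]monomial_sum linear_sum.
by apply: eq_bigr => i _; rewrite linearZ /= star_monomial mulrn_ord_opp.
Qed.

Lemma mul_star_eq0 u k :
  (0 < k)%N -> (n %| q ^ k + 1)%N -> u * star u = 0 -> u = 0.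
Proof.
move=> k_gt0 qk uu0.
have qk_gt1 : (1 < q ^ k)%N by rewrite -(exp1n k) ltn_exp2r ?finNzRing_gt1.
rewrite -[u]starK !(star_expX _ qk) -exprM.
have -> : (q ^ k * q ^ k = (q ^ k).+1 + (q ^ k * q ^ k - (q ^ k).+1))%N by nia.
by rewrite exprD exprS -(star_expX _ qk) uu0 mul0r.
Qed.

Section Orbit.
Hypothesis coprime_nq : coprime n q.
Local Notation mulq := (fun i : 'I_n => i *+ q).

Lemma expr_card_coef u i : (u ^+ q) 0 (i *+ q) = u 0 i.
Proof.
have := cyc_expX u 1; rewrite expn1 => ->.
rewrite summxE (bigD1 i) //= big1 => [|j ji].
  by rewrite !mxE !eqxx mulr1 addr0.
by rewrite !mxE eq_sym (inj_eq (mulrn_ord_inj coprime_nq)) (negPf ji) mulr0.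
Qed.

Definition orbit_sum : A := \row_i (fconnect mulq Zp1 i)%:R.

Lemma orbit_sum_expr_card : orbit_sum ^+ q = orbit_sum.
Proof.
have mulq_inj := mulrn_ord_inj coprime_nq.
apply/rowP => i; rewrite -(f_finv mulq_inj i) expr_card_coef !mxE.
by rewrite -(same_fconnect1_r mulq_inj).
Qed.

Lemma star_orbit_sum_neq :
  (forall k, (0 < k)%N -> ~~ (n %| q ^ k + 1)%N) -> star orbit_sum != orbit_sum.
Proof.
move=> q_neq; apply/eqP => /rowP/(_ Zp1); rewrite !mxE connect0.
case: (boolP (fconnect _ _ _)) => [|_ /eqP]; last by rewrite eq_sym oner_eq0.
rewrite (same_fconnect1 (mulrn_ord_inj coprime_nq)) => /iter_findex.
rewrite -iterSr iter_mulrn_expn => /Zp1_mulrn_opp; set k := (findex _ _ _).+1.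
by rewrite (negPf (q_neq k isT)).
Qed.

Lemma star_orthogonal_idempotent :
  (forall k, (0 < k)%N -> ~~ (n %| q ^ k + 1)%N) ->
  exists b : A, [/\ b * b = b, b * star b = 0 & b != 0].
Proof.
move=> /star_orbit_sum_neq/(idempotent_not_fixed orbit_sum_expr_card)[a aa sa].
exact: (orthogonal_idempotent starK aa sa).
Qed.

End Orbit.
End FrobeniusCyclic.

(** * Cyclic codes as ideals of the cyclic algebra *)

Section CyclicCodes.
Variables (R : finComUnitRingType) (m : nat).
Local Notation n := m.+1.
Local Notation S := (cyc_alg R m).
Implicit Types (C : {set 'rV[R]_n}) (u v w t : S).

Lemma is_codeP C : reflect
  [/\ 0 \in C, {in C &, forall u v, u + v \in C}
    & forall a, {in C, forall v, a *: v \in C}]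
  (is_code C).
Proof.
apply: (iffP and3P) => -[C0 CD CZ]; split=> //.
- by move=> u v uC; apply: (forall_inP (forall_inP CD u uC)).
- by move=> a v; apply: (forall_inP (forallP CZ a)).
- by apply/forall_inP => u uC; apply/forall_inP => v; apply: CD.
- by apply/forallP => a; apply/forall_inP; apply: CZ.
Qed.

Lemma dual_codeP C v :
  reflect {in C, forall u, inner v u = 0} (v \in dual_code C).
Proof.
by rewrite inE; apply: (iffP forall_inP) => vC u /vC; [move/eqP | move->].
Qed.

Lemma cshift_monomial v : cshift v = monomial R Zp1 * v.
Proof.
apply/rowP => k; rewrite mul_monomialE mxE; congr (v _ _); apply: val_inj => /=.
case: m k => [|l] k; first by rewrite ord1.
by rewrite modnDmr [(1 %% _)%N]modn_small // subn1 addnS.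
Qed.

Lemma mul_star_coef u v k : (u * star v) 0 k = inner u (monomial R k * v).
Proof.
by rewrite cyc_mulE; apply: eq_bigr => i _; rewrite mxE opprB mul_monomialE.
Qed.

Lemma cyclic_mul_monomial C v k :
  is_cyclic_code C -> v \in C -> monomial R k * v \in C.
Proof.
move=> /andP[_ /forall_inP shiftC] vC.
rewrite -[k]valZpK -Zp1_mulrn -monomialX.
elim: (val k) => [|l IHl]; first by rewrite mul1r.
by rewrite exprS -mulrA -cshift_monomial; apply: shiftC.
Qed.

Lemma cyclic_dualP C v : is_cyclic_code C ->
  reflect {in C, forall u, v * star u = 0} (v \in dual_code C).
Proof.
move=> cycC; apply: (iffP (dual_codeP C v)) => vC u uC; last first.
  have <- : monomial R 0 * u = u by exact: mul1r.
  by rewrite -mul_star_coef vC // mxE.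
apply/rowP => k; rewrite mul_star_coef vC ?mxE //.
exact: cyclic_mul_monomial.
Qed.

Definition ideal_code t : {set 'rV[R]_n} := [set t * (w : S) | w : 'rV[R]_n].

Lemma ideal_codeP t v : reflect (exists w, v = t * w) (v \in ideal_code t).
Proof. by apply: (iffP imsetP) => [[w _ ->]|[w ->]]; exists w. Qed.

Lemma ideal_code_cyclic t : is_cyclic_code (ideal_code t).
Proof.
apply/andP; split; [apply/is_codeP; split|apply/forall_inP].
- by apply/ideal_codeP; exists 0; rewrite mulr0.
- move=> _ _ /ideal_codeP[u ->] /ideal_codeP[v ->]; apply/ideal_codeP.
  by exists (u + v); rewrite mulrDr.
- move=> a _ /ideal_codeP[u ->]; apply/ideal_codeP.
  by exists (a *: u); rewrite scalerAr.
- move=> _ /ideal_codeP[u ->]; apply/ideal_codeP; exists (monomial R Zp1 * u).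
  by rewrite cshift_monomial mulrCA.
Qed.

Lemma ideal_code_self_dual t :
  (forall v, v * star t = 0 <-> exists w, v = t * w) ->
  self_dual (ideal_code t).
Proof.
move=> annt; apply/eqP/setP => v; have cyct := ideal_code_cyclic t.
apply/ideal_codeP/(cyclic_dualP _ cyct) => [/annt vt _ /ideal_codeP[w ->]|vt].
  by rewrite rmorphM mulrA vt mul0r.
by apply/annt/vt/ideal_codeP; exists 1; rewrite mulr1.
Qed.

Lemma trivial_codeP gamma e v :
  reflect (exists w, v = gamma ^+ e./2 *: w) (v \in trivial_code n gamma e).
Proof. by apply: (iffP imsetP) => [[w _ ->]|[w ->]]; exists w. Qed.

Lemma row_multiple (g : R) u :
  (forall i, exists b, u 0 i = g * b) -> exists w, u = g *: w.
Proof.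
move=> /fin_all_exists[f uf]; exists (\row_i f i).
by apply/rowP => i; rewrite !mxE.
Qed.

End CyclicCodes.

(** * Codes over a chain ring *)

Section ChainRing.
Variables (R : finComUnitRingType) (gamma : R) (e : nat).
Hypothesis gamma_max : nonunits R = principal_ideal gamma.
Hypothesis gamma_nilp : nilpotency_index gamma e.

Lemma nonunitE a : (a \isn't a GRing.unit) = (a \in principal_ideal gamma).
Proof. by rewrite -gamma_max inE. Qed.

Lemma nonunitP a : reflect (exists b, a = gamma * b) (a \isn't a GRing.unit).
Proof.
by rewrite nonunitE; apply: (iffP imsetP) => [[b _ ->]|[b ->]]; exists b.
Qed.

Lemma annihilator_gammaX k a : (k <= e)%N -> gamma ^+ k * a = 0 ->
  exists b, a = gamma ^+ (e - k) * b.
Proof.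
move=> ke ka.
suff: forall j, (j <= e - k)%N -> exists b, a = gamma ^+ j * b by apply.
elim=> [|j IHj] jk; first by exists a; rewrite mul1r.
have [b ab] := IHj (ltnW jk).
have [bU|/nonunitP[c bc]] := boolP (b \is a GRing.unit); last first.
  by exists c; rewrite ab bc mulrA exprSr.
have /gamma_nilp.2/negP[] : (k + j < e)%N by rewrite -ltn_subRL.
by rewrite -(mulIr_eq0 _ (mulIr bU)) exprD -mulrA -ab ka.
Qed.

Lemma card_residue_field (R_local : is_local_ring R) :
  #|{: residue_field R_local}| = #|residue_classes gamma|.
Proof.
have cosetE x : [set x + b | b in principal_ideal gamma] =
    residue R_local @^-1: [set residue R_local x].
  apply/setP => y; rewrite !inE -subr_eq0 -rmorphB residue_eq0 nonunitE.
  apply/imsetP/idP => [[b bg ->]|yx]; first by rewrite addrC addKr.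
  by exists (y - x); rewrite // addrC subrK.
have -> : residue_classes gamma =
    [set residue R_local @^-1: [set x] | x : residue_field R_local].
  apply/setP => X; apply/imsetP/imsetP => [[a _ ->]|[x _ ->]].
    by exists (residue R_local a); rewrite ?cosetE.
  by exists (residue_repr x); rewrite // cosetE (residue_reprK x).
rewrite card_imset // => x y /setP/(_ (residue_repr x)).
by rewrite !inE (residue_reprK x) eqxx => /esym/eqP.
Qed.

Variable m : nat.
Local Notation n := m.+1.
Local Notation S := (cyc_alg R m).
Implicit Types u v w : S.

Lemma annihilator_gammaX_row k u : (k <= e)%N -> gamma ^+ k *: u = 0 ->
  exists w, u = gamma ^+ (e - k) *: w.
Proof.
move=> ke ku; apply: row_multiple => i; apply: annihilator_gammaX => //.
by have /rowP/(_ i) := ku; rewrite !mxE.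
Qed.

Section IdempotentComponent.
Variables (t t' b : S) (k l : nat).
Hypotheses (kl : (k + l)%N = e) (b_idem : b * b = b).
Hypotheses (tb : t * b = gamma ^+ k *: b) (t'b : t' * b = gamma ^+ l *: b).

Lemma component_mul_eq0 : t * t' * b = 0.
Proof.
rewrite -mulrA t'b -scalerAr tb scalerA -exprD addnC kl.
by rewrite gamma_nilp.1 scale0r.
Qed.

Lemma component_annihilator v : v * t' = 0 -> exists w, v * b = t * w.
Proof.
move=> vt'; have /annihilator_gammaX_row[|w vb] : gamma ^+ l *: (v * b) = 0.
- by rewrite scalerAr -t'b mulrA vt' mul0r.
- by rewrite -kl leq_addl.
exists (b * w); rewrite -{1}b_idem mulrA vb -kl addnK mulrA tb.
by rewrite -!scalerAl [w * b]mulrC.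
Qed.

End IdempotentComponent.

Section UnbalancedGenerator.
Variables (h : nat) (a : S).
Hypotheses (eE : e = h.*2.+2) (a_idem : a * a = a) (a_orth : a * star a = 0).

Definition orth_complement : S := 1 - a - star a.
Local Notation d := orth_complement.

Definition unbalanced_generator : S :=
  gamma ^+ h *: a + gamma ^+ h.+2 *: star a + gamma ^+ h.+1 *: d.
Local Notation t := unbalanced_generator.

Lemma star_idem : star a * star a = star a.
Proof. by rewrite -rmorphM a_idem. Qed.

Lemma star_complement : star d = d.
Proof. by rewrite /d !rmorphB rmorph1 /= starK addrAC. Qed.

Lemma complement_orth : a * d = 0.
Proof. by rewrite /d !mulrBr mulr1 a_idem a_orth subr0 subrr. Qed.

Lemma star_complement_orth : star a * d = 0.
Proof. by rewrite -star_complement -rmorphM complement_orth rmorph0. Qed.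

Lemma complement_idem : d * d = d.
Proof.
by rewrite {1}/d !mulrBl mul1r complement_orth star_complement_orth !subr0.
Qed.

Lemma generator_idem : t * a = gamma ^+ h *: a.
Proof.
rewrite mulrC /t !mulrDr -!scalerAr a_idem a_orth complement_orth.
by rewrite !scaler0 !addr0.
Qed.

Lemma generator_star_idem : t * star a = gamma ^+ h.+2 *: star a.
Proof.
rewrite mulrC /t !mulrDr -!scalerAr star_idem star_complement_orth.
by rewrite [star a * a]mulrC a_orth !scaler0 addr0 add0r.
Qed.

Lemma generator_complement : t * d = gamma ^+ h.+1 *: d.
Proof.
rewrite mulrC /t !mulrDr -!scalerAr complement_idem [d * a]mulrC.
by rewrite [d * _]mulrC complement_orth star_complement_orth !scaler0 !add0r.
Qed.

(* star exchanges the components along a and star a, so that on each component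
   the exponents of gamma in t and star t add up to e. *)
Lemma annihilator_star_generator v : v * star t = 0 <-> exists w, v = t * w.
Proof.
have decomp u : u = u * a + u * star a + u * d by rewrite /d; ring.
have ta := generator_idem; have tsa := generator_star_idem.
have td := generator_complement.
have sta : star t * a = gamma ^+ h.+2 *: a.
  by rewrite -{1}[a]starK -rmorphM /= tsa linearZ /= starK.
have stsa : star t * star a = gamma ^+ h *: star a.
  by rewrite -rmorphM /= ta linearZ.
have std : star t * d = gamma ^+ h.+1 *: d.
  by rewrite -{1}star_complement -rmorphM /= td linearZ /= star_complement.
have ea : (h + h.+2)%N = e by lia.
have esa : (h.+2 + h)%N = e by lia.
have ed : (h.+1 + h.+1)%N = e by lia.
split=> [vt|[w ->]].
  have [w0 va] := component_annihilator ea a_idem ta sta vt.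
  have [w1 vsa] := component_annihilator esa star_idem tsa stsa vt.
  have [w2 vd] := component_annihilator ed complement_idem td std vt.
  by exists (w0 + w1 + w2); rewrite [v]decomp va vsa vd !mulrDr.
suff tt0 : t * star t = 0 by rewrite mulrAC tt0 mul0r.
rewrite [t * star t]decomp (component_mul_eq0 ea ta sta).
rewrite (component_mul_eq0 esa tsa stsa) (component_mul_eq0 ed td std).
by rewrite !addr0.
Qed.

End UnbalancedGenerator.

Section Reduction.
Hypothesis R_local : is_local_ring R.
Local Notation K := (residue_field R_local).
Local Notation red := (cyc_map (residue R_local) (m := m)).

Lemma reduction_surj x : exists u, red u = x.
Proof.
exists (map_mx (@residue_repr _ R_local) x); apply/rowP => k; rewrite !mxE.
exact: residue_reprK.
Qed.

Lemma reduction_eq0P u : red u = 0 <-> exists w, u = gamma *: w.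
Proof.
have resP a : residue R_local a = 0 <-> exists b, a = gamma * b.
  by split=> [/eqP|ga]; [|apply/eqP]; rewrite residue_eq0; apply/nonunitP.
split=> [/rowP u0|[w ->]]; last first.
  by apply/rowP => k; rewrite !mxE; apply/resP; exists (w 0 k).
by apply: row_multiple => i; apply/resP; have := u0 i; rewrite !mxE.
Qed.

Lemma reduction_ker_nilp u : red u = 0 -> u ^+ e = 0.
Proof.
by move=> /reduction_eq0P[w ->]; rewrite exprZn gamma_nilp.1 scale0r.
Qed.

Lemma gammaX_reduction_eq0 k u : (k < e)%N -> gamma ^+ k *: u = 0 -> red u = 0.
Proof.
move=> ke /(annihilator_gammaX_row (ltnW ke))[w ->]; apply/reduction_eq0P.
by exists (gamma ^+ (e - k).-1 *: w); rewrite scalerA -exprS prednK // subn_gt0.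
Qed.

Hypothesis e_even : ~~ odd e.

Lemma self_dual_cyclic_trivial (C : {set 'rV[R]_n}) i :
  (0 < i)%N -> (n %| #|{: K}| ^ i + 1)%N ->
  is_cyclic_code C -> self_dual C -> C = trivial_code n gamma e.
Proof.
move=> i_gt0 qi cycC /eqP dualC; have e2 := even_halfK e_even.
have sub_trivial : {subset C <= trivial_code n gamma e}.
  move=> v vC; apply/trivial_codeP.
  suff: forall k, (k <= e./2)%N -> exists w, v = gamma ^+ k *: w by apply.
  elim=> [|k IHk] ke; first by exists v; rewrite scale1r.
  have [w vw] := IHk (ltnW ke).
  have /(cyclic_dualP _ cycC)/(_ v vC) : v \in dual_code C by rewrite -dualC.
  rewrite vw linearZ /= -scalerAl -scalerAr scalerA -exprD.
  move=> /gammaX_reduction_eq0; rewrite rmorphM /= cyc_map_star => ww0.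
  have /reduction_eq0P[w' ->] : red w = 0.
    by apply: (mul_star_eq0 i_gt0 qi); apply: ww0; lia.
  by exists w'; rewrite scalerA exprSr.
apply/eqP; rewrite eqEsubset; apply/andP; split; apply/subsetP => // v.
move=> /trivial_codeP[w ->]; rewrite dualC; apply/(cyclic_dualP _ cycC) => u.
move=> /sub_trivial/trivial_codeP[w' ->].
rewrite linearZ /= -scalerAl -scalerAr scalerA -exprD addnn e2.
by rewrite gamma_nilp.1 scale0r.
Qed.

Lemma unbalanced_code_nontrivial h a :
  e = h.*2.+2 -> a * a = a -> a * star a = 0 -> red a != 0 ->
  ideal_code (unbalanced_generator h a) != trivial_code n gamma e.
Proof.
move=> eE a_idem a_orth; apply: contraNneq => trivC.
apply/eqP/(@gammaX_reduction_eq0 (h.+1 + h)); first by lia.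
have : gamma ^+ h *: a \in trivial_code n gamma e.
  by rewrite -trivC -generator_idem //; apply/ideal_codeP; exists a.
move=> /trivial_codeP[w]; rewrite exprD -scalerA => ->.
have he : (h.+1 + e./2)%N = e by lia.
by rewrite scalerA -exprD he gamma_nilp.1 scale0r.
Qed.

Lemma nontrivial_self_dual_exists : coprime n #|{: K}| ->
  (forall i, (0 < i)%N -> ~~ (n %| #|{: K}| ^ i + 1)%N) ->
  exists C : {set 'rV[R]_n},
    [/\ is_cyclic_code C, self_dual C & C != trivial_code n gamma e].
Proof.
move=> coprime_nq q_neq.
have [b [bb sb b0]] := star_orthogonal_idempotent coprime_nq q_neq.
have red_star u : red (star u) = star (red u) by apply: cyc_map_star.
have [a [a_idem a_orth ab]] := lift_orthogonal_idempotent
  reduction_ker_nilp red_star (reduction_surj b) bb sb.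
have [h eE] : exists h, e = h.*2.+2.
  case: e gamma_nilp.1 (even_halfK e_even) => [/eqP|[|l] // _ <-].
    by rewrite oner_eq0.
  by exists l./2.
exists (ideal_code (unbalanced_generator h a)); split.
- exact: ideal_code_cyclic.
- exact/ideal_code_self_dual/annihilator_star_generator.
- by apply: unbalanced_code_nontrivial; rewrite // ab.
Qed.

End Reduction.
End ChainRing.

Lemma eqz_mod_opp1 (n k : nat) :
  (k%:Z = - 1 %[mod n%:Z])%Z <-> (n %| k + 1)%N.
Proof.
by split=> [/eqP|nk]; [|apply/eqP]; rewrite eqz_mod_dvd opprK -PoszD.
Qed.

Theorem mainTheorem7 (R : finComUnitRingType) (gamma : R) (e p r n : nat) :
  is_chain_ring R ->
  nonunits R = principal_ideal gamma ->
  nilpotency_index gamma e ->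
  ~~ odd e ->
  prime p ->
  #|residue_classes gamma| = (p ^ r)%N ->
  (0 < n)%N ->
  coprime n p ->
  (exists C : {set 'rV[R]_n},
      [/\ is_cyclic_code C, self_dual C & C != trivial_code n gamma e])
  <->
  (forall i : nat, (0 < i)%N -> ~ (((p ^ r) ^ i)%:Z = - 1 %[mod n%:Z])%Z).
Proof.
case: n => // m /andP[R_local _] gamma_max gamma_nilp e_even _ card_res _ np.
have card_K := card_residue_field gamma_max R_local; rewrite card_res in card_K.
split=> [[C [cycC dualC nontrivC]] i i_gt0 /eqz_mod_opp1 | q_neq].
  rewrite -card_K => qi; move: nontrivC.
  have trivC := self_dual_cyclic_trivial gamma_max gamma_nilp e_even i_gt0 qi.
  by rewrite (trivC C cycC dualC) eqxx.
apply: (nontrivial_self_dual_exists _ _ (R_local := R_local)) => //.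
  by rewrite card_K coprimeXr.
by move=> i i_gt0; rewrite card_K; apply/negP => /eqz_mod_opp1; apply: q_neq.
Qed.
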